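(* Let $\mathcal R$ be the compositum of all real quadratic integer rings $\mathcal O_{\mathbb{Q}(\sqrt{d})}$ with $d>1$ squarefree. Let $A$ be an indecomposable cyclotomic matrix with entries in $\mathcal R$. Then $A$ is a symmetric matrix over one of the rings $\mathbb{Z}$, $\mathbb{Z}[\sqrt{2}]$, $\mathbb{Z}[\varphi]$, or $\mathbb{Z}[\sqrt{3}]$, where $\varphi=\frac12+\frac{\sqrt5}{2}$.
   Context: A real symmetric matrix $A$ is cyclotomic if its characteristic polynomial $\det(xI-A)$ has integer coefficients and all its eigenvalues lie in $[-2,2]$. A square matrix $A=(a_{uv})$ is indecomposable if its underlying graph (vertices $u\neq v$ adjacent iff $a_{uv}\neq 0$) is connected. *)

(* Defs.v *)
From HB Require Import structures.
From mathcomp Require Import all_boot all_order all_algebra all_field.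
Set Implicit Arguments. Unset Strict Implicit. Unset Printing Implicit Defensive.
Import Order.TTheory GRing.Theory Num.Theory.
Local Open Scope ring_scope.

Definition squarefree (d : nat) : Prop :=
  forall p : nat, prime p -> ~~ (p * p %| d)%N.

Definition in_Qsqrt (d : nat) (x : algC) : Prop :=
  exists a b : rat, x = ratr a + ratr b * sqrtC d%:R.

Definition in_quad_int (d : nat) (x : algC) : Prop :=
  in_Qsqrt d x /\ x \in Aint.

Inductive in_Rcomp : algC -> Prop :=
| Rcomp_quad (d : nat) (x : algC) :
    (1 < d)%N -> squarefree d -> in_quad_int d x -> in_Rcomp x
| Rcomp_one : in_Rcomp 1
| Rcomp_add x y : in_Rcomp x -> in_Rcomp y -> in_Rcomp (x + y)
| Rcomp_opp x : in_Rcomp x -> in_Rcomp (- x)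
| Rcomp_mul x y : in_Rcomp x -> in_Rcomp y -> in_Rcomp (x * y).

Definition cyclotomic_mx (n : nat) (A : 'M[algC]_n) : Prop :=
  [/\ A^T = A,
      (forall i j, A i j \is Num.real),
      (forall k, (char_poly A)`_k \in Num.int)
    & (forall x, eigenvalue A x -> -2 <= x <= 2)].

Definition mx_graph (n : nat) (A : 'M[algC]_n) : rel 'I_n :=
  fun u v => (u != v) && (A u v != 0).

Definition indecomposable (n : nat) (A : 'M[algC]_n) : Prop :=
  forall u v : 'I_n, connect (mx_graph A) u v.

Definition in_Zadj (w x : algC) : Prop :=
  exists a b : int, x = a%:~R + b%:~R * w.

Definition phi_gold : algC := (1 + sqrtC 5%:R) / 2%:R.

(* Main.v *)
Require Import Defs.
From HB Require Import structures.
From mathcomp Require Import all_boot all_order all_algebra all_field.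
From mathcomp Require Import zify ring lra.
Import Order.TTheory GRing.Theory Num.Theory.
Local Open Scope ring_scope.
Set Implicit Arguments. Unset Strict Implicit. Unset Printing Implicit Defensive.

(* Every conjugate of A is again cyclotomic, so each entry a of A has all its
   conjugates in [-2, 2]; write a = z + 1/z with |z| = 1.  For a prime p, every
   x in R satisfies x^(p^3) = x^p modulo p, since this holds for quadratic
   integers and both sides are additive modulo p.  Applied to a, this makes
   (z^(p^3) + z^(-p^3) - z^p - z^(-p)) / p an algebraic integer, which vanishes
   for p > 4 because all its conjugates are smaller than 1.  The primes 5 and 7
   give z^24 = 1 or z^10 = 1, and p = 2 rules out the elements of order 24.
   Hence an entry that is not a rational integer is, up to sign, sqrt 2, sqrt 3,
   phi or 1/phi.

   If two irrationalities occurred in A, take a shortest path between two rows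
   containing them.  A vector supported on that path, with weights chosen as in
   the affine diagrams with two multiple end bonds, violates the bound 2 on the
   operator norm of A: one of the end bonds has weight at least sqrt 2, the other
   one (after conjugation) more than sqrt 2.  Using the bilinear form
   instead of the quadratic one makes the diagonal entries of A harmless. *)

(** * Congruences between algebraic integers *)

Lemma eqAmodX (e : algC) (k : nat) (x y : algC) : x \in Aint -> y \in Aint ->
  (x == y %[mod e])%A -> (x ^+ k == y ^+ k %[mod e])%A.
Proof.
move=> xA yA xy; elim: k => [|k IH]; first by rewrite !expr0 eqAmod_refl.
by rewrite !exprS eqAmodM // rpredX.
Qed.

(** The middle binomial coefficients of a [p]-th power are multiples of [p], so Frobenius is
    additive modulo [p]; induction on [k] iterates this. *)
Lemma eqAmodXD (p k : nat) (x y : algC) : prime p -> x \in Aint -> y \in Aint ->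
  ((x + y) ^+ (p ^ k) == x ^+ (p ^ k) + y ^+ (p ^ k) %[mod p])%A.
Proof.
move=> pp xA yA; elim: k => [|k IH]; first by rewrite !expn0 !expr1 eqAmod_refl.
rewrite !expnSr !exprM.
apply: (@eqAmod_trans _ ((x ^+ (p ^ k) + y ^+ (p ^ k)) ^+ p)).
  by apply: eqAmodX IH; rewrite ?rpredD ?rpredX ?rpredD.
have := rpredX (p ^ k) yA; have := rpredX (p ^ k) xA.
move: (x ^+ (p ^ k)) (y ^+ (p ^ k)) => {IH k}a b {x xA y yA} aA bA.
case: p pp => // p pp; rewrite exprDn big_ord_recl big_ord_recr /=.
rewrite /bump /= !add1n subn0 subnn !expr0 !mulr1 !mul1r bin0 binn !mulr1n.
rewrite eqAmodDl -[X in (_ == X %[mod _])%A]add0r eqAmodDr eqAmod0.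
apply: rpred_sum => i _; rewrite /bump /= add1n.
have /dvdnP[m ->] : (p.+1 %| 'C(p.+1, i.+1))%N.
  by apply: prime_dvd_bin => //; apply: (ltn_ord i).
rewrite -mulr_natl natrM -mulrA mulrCA -eqAmod0 eqAmodMr0 //.
by rewrite rpredM ?rpred_nat // rpredM ?rpredX.
Qed.

Lemma eqAmod_Fermat (p : nat) (t : algC) : prime p -> t \in Num.int ->
  (t ^+ p == t %[mod p])%A.
Proof.
move=> pp /intrP[m ->{t}].
have natF k : (k%:R ^+ p == k%:R %[mod p])%A.
  rewrite -natrX eqAmod_nat.
  elim: k => [|k IH]; first by rewrite exp0n ?prime_gt0.
  have := eqAmodXD 1 pp (rpred_nat _ k) (rpred1 _).
  rewrite expn1 natr1 expr1n -!natrX natr1 eqAmod_nat => /eqP ->.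
  by rewrite -addn1 -modnDml (eqP IH) modnDml addn1.
case: m => k; first exact: natF.
rewrite NegzE mulrNz -mulN1r exprMn.
apply: (@eqAmod_trans _ ((-1) ^+ p * k.+1%:R)).
  by rewrite eqAmodMl ?natF // rpredX // rpredN rpred1.
have [p2|] := even_prime pp; last by move=> op; rewrite -signr_odd op eqAmod_refl.
rewrite p2 sqrrN expr1n /eqAmod -mulrBl opprK -eqAmod0 eqAmodMr0 //.
exact: rpred_nat.
Qed.

(** For irrational [x] the given rational quadratic is the minimal polynomial, and an algebraic
    integer has an integral minimal polynomial. *)
Lemma quadratic_Aint_coefs (a c : rat) (x : algC) : x \in Aint ->
  x ^+ 2 = ratr a * x - ratr c ->
  exists t m, [/\ t \in Num.int, m \in Num.int & x ^+ 2 = t * x - m].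
Proof.
move=> xA xE; have [xQ|xQ] := boolP (x \in Crat).
  have xZ := Cint_rat_Aint xQ xA.
  (* A rational [x] is an integer and serves as the double root of (X - x)^2. *)
  exists (x * 2), (x ^+ 2); split; rewrite ?rpredM ?rpredX ?rpred_nat //; ring.
have [q [Dq mon_q] dv_q] := minCpolyP x.
pose r : {poly rat} := 'X^2 - a *: 'X + c%:P.
have szr : size ('X^2 + (- (a *: 'X) + c%:P)) = 3%N.
  rewrite size_polyDl size_polyXn //.
  rewrite (leq_ltn_trans (size_polyD _ _)) // gtn_max size_polyN.
  rewrite (leq_ltn_trans (size_scale_leq _ _)) ?size_polyX //.
  by rewrite (leq_ltn_trans (size_polyC_leq1 _)).
have mon_r : r \is monic.
  rewrite monicE lead_coefE /r -addrA szr !coefE /=.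
  by rewrite mulr0 oppr0 !addr0.
have : root (map_poly ratr r) x.
  rewrite rootE /r rmorphD rmorphB /= map_polyZ map_polyXn map_polyX map_polyC.
  by rewrite !hornerE xE; apply/eqP => /=; ring.
rewrite dv_q => qr.
have qE : q = r.
  apply/eqP; rewrite -eqp_monic // -dvdp_size_eqp // /r -addrA szr eqn_leq.
  have := dvdp_leq (monic_neq0 mon_r) qr; rewrite {1}/r -addrA szr => -> /=.
  (* A minimal polynomial of degree 1 would make [x] rational. *)
  have := size_minCpoly x; rewrite Dq size_map_poly leq_eqVlt => /orP[/eqP sq|//].
  case/negP: xQ; have := root_minCpoly x; rewrite Dq rootE.
  have -> : q = 'X + (q`_0)%:P.
    apply/polyP=> -[|[|i]]; rewrite !coefE /= ?add0r ?addr0 //.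
      by move: mon_q; rewrite monicE lead_coefE -sq => /eqP.
    by rewrite nth_default -?sq.
  rewrite rmorphD /= map_polyX map_polyC !hornerE /= addr_eq0 => /eqP ->.
  by rewrite rpredN rpred_rat.
have coefZ i : (ratr (r`_i) : algC) \in Num.int.
  by move: xA; rewrite unfold_in => /polyOverP /(_ i); rewrite Dq coef_map qE.
exists (ratr a), (ratr c); split => //.
  have := coefZ 1%N; rewrite /r !coefE /= mulr1 addr0 sub0r.
  by rewrite rmorphN rpredN.
by have := coefZ 0%N; rewrite /r !coefE /= mulr0 subr0 add0r.
Qed.

Lemma eqAmod_nat_div (p : nat) (x y : algC) : (0 < p)%N ->
  (x == y %[mod p])%A = ((x - y) / p%:R \in Aint).
Proof.
by move=> p0; rewrite /eqAmod [LHS]unfold_in [_ == 0](pnatr_eq0 algC) gtn_eqF.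
Qed.

Lemma eqAmod_Fermat3 (p : nat) (t : algC) : prime p -> t \in Num.int ->
  (t ^+ (p ^ 3) == t ^+ p %[mod p])%A.
Proof.
move=> pp tZ; have tA := Aint_Cint tZ.
have FX : (t ^+ p == t %[mod p])%A by apply: eqAmod_Fermat.
rewrite (expnS p 2) exprM (expnS p 1) exprM expn1.
have F1 := eqAmodX p (rpredX p tA) tA FX.
have F2 := eqAmodX p (rpredX p (rpredX p tA)) (rpredX p tA) F1.
exact: eqAmod_trans F2 F1.
Qed.

(** Completing the square gives y = 2x - t with y^2 = D, the discriminant. Modulo [p], Frobenius
    multiplies [y] by E = D^((p-1)/2), the Legendre symbol of [D], and E^3 = E. Comparing the
    exponents p^3 and p, rather than p^2 and 1, includes the ramified primes, where [E] vanishes. *)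
Lemma quadratic_frob_odd (p : nat) (t m x : algC) : prime p -> odd p ->
  t \in Num.int -> m \in Num.int -> x \in Aint -> x ^+ 2 = t * x - m ->
  (x ^+ (p ^ 3) == x ^+ p %[mod p])%A.
Proof.
move=> pp podd tZ mZ xA xE.
have tA := Aint_Cint tZ; have mA := Aint_Cint mZ.
set D := t ^+ 2 - 4 * m; set y := 2 * x - t.
have DZ : D \in Num.int by rewrite rpredB ?rpredM ?rpredX ?rpred_nat.
have DA := Aint_Cint DZ.
have yA : y \in Aint by rewrite rpredB ?rpredM ?rpred_nat.
have y2 : y ^+ 2 = D.
  have -> : y ^+ 2 = 4 * x ^+ 2 - 4 * t * x + t ^+ 2 by rewrite /y; ring.
  by rewrite xE /D; ring.
have pE : p = (p./2).*2.+1 by rewrite -[LHS]odd_double_half podd.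
have p2 : (0 < p./2)%N by case: (p) pp podd => [|[|[|]]].
have yp : y ^+ p = D ^+ p./2 * y by rewrite [in LHS]pE -mul2n exprSr exprM y2.
set E := D ^+ p./2 in yp.
have EZ : E \in Num.int by rewrite rpredX.
have EA := Aint_Cint EZ.
have Ep : (E ^+ p == E %[mod p])%A by apply: eqAmod_Fermat.
have E3 : (E ^+ 3 == E %[mod p])%A.
  have -> : E ^+ 3 = D ^+ (p./2).-1 * D ^+ p.
    rewrite /E -exprM.
    have -> : (p./2 * 3 = p./2.-1 + p)%N by move: pE p2; clear; lia.
    by rewrite exprD.
  have -> : E = D ^+ (p./2).-1 * D by rewrite -exprSr prednK.
  by rewrite eqAmodMl ?rpredX // eqAmod_Fermat.
have y3 : (y ^+ (p ^ 3) == y ^+ p %[mod p])%A.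
  have EyA : E * y \in Aint by rewrite rpredM.
  have s1 : ((E * y) ^+ p == E * (E * y) %[mod p])%A.
    by rewrite exprMn yp eqAmodMr.
  have s2 : ((E * (E * y)) ^+ p == E * (E * (E * y)) %[mod p])%A.
    by rewrite exprMn eqAmodM ?rpredX ?rpredM.
  rewrite (expnS p 2) exprM (expnS p 1) exprM expn1 yp.
  apply: eqAmod_trans (eqAmodX p _ _ s1) _; rewrite ?rpredX ?rpredM //.
  apply: eqAmod_trans s2 _.
  have -> : E * (E * (E * y)) = E ^+ 3 * y by ring.
  by rewrite eqAmodMr.
have x2 : 2 * x = t + y by rewrite /y; ring.
have tx : ((2 * x) ^+ (p ^ 3) == (2 * x) ^+ p %[mod p])%A.
  rewrite x2; apply: eqAmod_trans (eqAmodXD 3 pp tA yA) _.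
  rewrite eqAmod_sym -[X in (_ ^+ X == _ %[mod _])%A]expn1.
  apply: eqAmod_trans (eqAmodXD 1 pp tA yA) _.
  by rewrite expn1 eqAmod_sym eqAmodD // eqAmod_Fermat3.
have {}tx : (2 * x ^+ (p ^ 3) == 2 * x ^+ p %[mod p])%A.
  have two k : (2 ^+ (p ^ k) * x ^+ (p ^ k) == 2 * x ^+ (p ^ k) %[mod p])%A.
    rewrite eqAmodMr ?rpredX //; elim: k => [|k IH]; first by rewrite eqAmod_refl.
    rewrite expnSr exprM; apply: eqAmod_trans (eqAmod_Fermat pp (rpred_nat _ 2)).
    by apply: eqAmodX IH; rewrite ?rpredX ?rpred_nat.
  have := two 3%N; rewrite eqAmod_sym => /eqAmod_trans -> //.
  rewrite -exprMn; apply: eqAmod_trans tx _.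
  by have := two 1%N; rewrite expn1 -exprMn.
(* [p./2 + 1] inverts 2 modulo [p]. *)
have inv2 z : z \in Aint -> (z == (p./2.+1)%:R * (2 * z) %[mod p])%A.
  move=> zA; rewrite eqAmod_sym mulrA -natrM.
  have -> : (p./2.+1 * 2 = p + 1)%N by move: pE; clear; lia.
  by rewrite natrD mulrDl mul1r [_%:R * z]mulrC eqAmod_addl_mul.
apply: eqAmod_trans (inv2 _ _) _; first by rewrite rpredX.
rewrite eqAmod_sym; apply: eqAmod_trans (inv2 _ _) _; first by rewrite rpredX.
by rewrite eqAmodMl ?rpred_nat // eqAmod_sym.
Qed.

(** The square cannot be completed modulo 2, so the parity of [t] decides. For even [t], x^2 is
    congruent to [m] and hence x^4 to x^2; for odd [t], x^2 is congruent to x + m and hence x^4 to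
    x. Either way x^8 is congruent to x^2. *)
Lemma quadratic_frob2 (t m x : algC) :
  t \in Num.int -> m \in Num.int -> x \in Aint -> x ^+ 2 = t * x - m ->
  (x ^+ 8 == x ^+ 2 %[mod 2%N])%A.
Proof.
move=> tZ mZ xA xE.
have tA := Aint_Cint tZ; have mA := Aint_Cint mZ.
have mod2 y z w : w \in Aint -> y - z = 2 * w -> (y == z %[mod 2%N])%A.
  by move=> wA yzE; rewrite /eqAmod yzE -eqAmod0 eqAmodMr0.
have [j jA m2] : exists2 j, j \in Aint & m ^+ 2 = m + 2 * j.
  exists ((m ^+ 2 - m) / 2); last by field.
  have := eqAmod_Fermat (isT : prime 2) mZ.
  by rewrite eqAmod_nat_div.
have [k kZ kE] : exists2 k, k \in Num.int & t = 2 * k \/ t = 2 * k + 1.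
  have /intrP[a ->] := tZ; exists ((a %/ 2)%Z%:~R); first exact: rpred_int.
  rewrite {1 3}(divz_eq a 2).
  have := modz_ge0 a (isT : 2 != 0 :> int); have := @ltz_pmod a 2 isT.
  by case: (a %% 2)%Z => [[|[|]]|] // _ _; [left|right]; rewrite rmorphD rmorphM /=; ring.
have kA := Aint_Cint kZ; pose c := k * x; have cA : c \in Aint by rewrite rpredM.
have Aring z : z \in Aint -> 2 * z \in Aint by move=> zA; rewrite rpredM ?rpred_nat.
suff x4 : (x ^+ 4 == x ^+ 2 %[mod 2%N])%A \/ (x ^+ 4 == x %[mod 2%N])%A.
  have x8 : x ^+ 8 = (x ^+ 4) ^+ 2 by rewrite -exprM.
  rewrite x8; case: x4 => x4; last by apply: eqAmodX; rewrite ?rpredX.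
  have := eqAmodX 2 (rpredX 4 xA) (rpredX 2 xA) x4; rewrite -[(x ^+ 2) ^+ 2]exprM.
  by move=> /eqAmod_trans; apply.
case: kE => kE; [left|right].
- have x2 : x ^+ 2 = 2 * c - m by rewrite xE kE /c; ring.
  apply: (mod2 _ _ (2 * c ^+ 2 - 2 * (c * m) - c + m + j)).
    by do ?[assumption | apply: Aring | apply: rpredB | apply: rpredD | apply: rpredX | apply: rpredM].
  have -> : x ^+ 4 = (x ^+ 2) ^+ 2 by rewrite -exprM.
  have -> : (x ^+ 2) ^+ 2 - x ^+ 2 = 4 * c ^+ 2 - 4 * c * m + m ^+ 2 - 2 * c + m.
    by rewrite x2; ring.
  by rewrite m2; ring.
have x2 : x ^+ 2 = x + 2 * c - m by rewrite xE kE /c; ring.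
apply: (mod2 _ _ (c - x * m + j + 2 * (c * (x - m)) + 2 * c ^+ 2)).
  by do ?[assumption | apply: Aring | apply: rpredB | apply: rpredD | apply: rpredX | apply: rpredM].
have -> : x ^+ 4 = (x ^+ 2) ^+ 2 by rewrite -exprM.
have -> : (x ^+ 2) ^+ 2 - x =
    x ^+ 2 - 2 * x * m + m ^+ 2 + 4 * c * (x - m) + 4 * c ^+ 2 - x.
  by rewrite {1}x2; ring.
by rewrite m2 x2; ring.
Qed.

(** * Algebraic integers whose conjugates are all small *)

Lemma galois_num_field (y : algC) : {Qn : splittingFieldType rat & galois 1 {:Qn} &
  {QnC : {rmorphism Qn -> algC} & exists a, QnC a = y}}.
Proof.
have [rs Drs] := closed_field_poly_normal (minCpoly y).
have [Qn [QnC [rs1 Drs1 genQn]]] := num_field_exists rs.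
have [q [Dq mon_q] _] := minCpolyP y.
rewrite (monicP (minCpoly_monic y)) scale1r in Drs.
have splitq : splittingFieldFor 1 (map_poly (in_alg Qn) q) {:Qn}.
  exists rs1; last exact: genQn.
  suff -> : map_poly (in_alg Qn) q = \prod_(r <- rs1) ('X - r%:P) by rewrite eqpxx.
  apply: (map_poly_inj QnC); rewrite -map_poly_comp rmorph_prod /=.
  rewrite (@eq_map_poly _ _ _ ratr) => [|a]; last first.
    by rewrite /= rmorphZ_num rmorph1 mulr1.
  rewrite -Dq Drs -Drs1 big_map; apply: eq_bigr => r _.
  by rewrite map_polyXsubC.
have Qn_ax : FieldExt_isSplittingField _ Qn.
  by constructor; exists (map_poly (in_alg Qn) q) => //; apply/polyOver1P; exists q.
pose L : splittingFieldType rat := HB.pack_for (splittingFieldType rat) Qn Qn_ax.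
exists L.
  rewrite /galois sub1v normalFieldf andbT; apply/separableP=> a _.
  apply: pcharf0_separable => p; rewrite -(fmorph_pchar QnC); exact: pchar_num.
exists QnC.
have : y \in rs by rewrite -root_prod_XsubC -Drs root_minCpoly.
by rewrite -Drs1 => /mapP[a _ ->]; exists a.
Qed.

(** The norm of [y] from a Galois number field is a rational integer. It is a product of conjugates,
    since Galois automorphisms extend to [algC], so its absolute value is below 1 and it
    vanishes. *)
Lemma Aint_conj_lt1_eq0 (y : algC) : y \in Aint ->
  (forall u : {rmorphism algC -> algC}, `|u y| < 1) -> y = 0.
Proof.
move=> yA ylt1; have [Qn galQn [QnC [a Da]]] := galois_num_field y.
have gQnC nu := extend_algC_subfield_aut QnC nu.
pose beta := QnC (galNorm 1 {:Qn} a).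
have Dbeta : beta = \prod_(nu in 'Gal({:Qn} / 1)%g) sval (gQnC nu) y.
  rewrite /beta rmorph_prod; apply: eq_bigr => nu _.
  by case: (gQnC nu) => f /= ->; rewrite Da.
have Zbeta : beta \in Num.int.
  apply: Cint_rat_Aint; last by rewrite Dbeta rpred_prod // => nu _; rewrite Aint_aut.
  rewrite /beta; have /vlineP[/= c ->] := mem_galNorm galQn (memvf a).
  by rewrite alg_num_field fmorph_rat rpred_rat.
have [/eqP //|nz_y] := boolP (y == 0).
have: beta != 0 by rewrite Dbeta; apply/prodf_neq0 => nu _; rewrite fmorph_eq0.
move/(norm_intr_ge1 Zbeta); rewrite lt_geF // Dbeta normr_prod.
rewrite (bigD1 (1%g : gal_of {:Qn})) ?group1 //=.
apply: le_lt_trans (ylt1 (sval (gQnC (1%g : gal_of {:Qn})))).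
rewrite ler_piMr ?normr_ge0 // prodr_ile1 // => nu _.
by rewrite normr_ge0 ltW.
Qed.

(** * The entries of a cyclotomic matrix *)

Section RcompEntries.
Implicit Types (u : {rmorphism algC -> algC}) (a x z : algC).

Lemma sqrtC_nat_real (d : nat) : sqrtC (d%:R : algC) \is Num.real.
Proof. by rewrite ger0_real // sqrtC_ge0 ler0n. Qed.

Lemma in_Rcomp_real x : in_Rcomp x -> x \is Num.real.
Proof.
elim=> {x} [d x _ _ [[a [b ->]] _]||x y _ xR _ yR|x _ xR|x y _ xR _ yR].
- have ratR (c : rat) : (ratr c : algC) \is Num.real by rewrite Creal_Crat ?Crat_rat.
  by apply: rpredD => //; apply: rpredM => //; apply: sqrtC_nat_real.
- exact: rpred1.
- exact: rpredD.
- by rewrite rpredN.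
- exact: rpredM.
Qed.

Lemma in_Rcomp_Aint x : in_Rcomp x -> x \in Aint.
Proof.
elim=> {x} [d x _ _ [_ //]||x y _ xR _ yR|x _ xR|x y _ xR _ yR].
- exact: rpred1.
- exact: rpredD.
- by rewrite rpredN.
- exact: rpredM.
Qed.

(** An automorphism fixes the rationals and sends [sqrtC d] to plus or minus itself, so it preserves
    each quadratic ring of integers. *)
Lemma in_Rcomp_aut u x : in_Rcomp x -> in_Rcomp (u x).
Proof.
elim=> {x} [d x d1 sqf [[a [b xE]] xA]||x y _ xR _ yR|x _ xR|x y _ xR _ yR].
- apply: (Rcomp_quad d1 sqf); split; last by rewrite Aint_aut.
  have : (u (sqrtC d%:R)) ^+ 2 == (sqrtC d%:R) ^+ 2.
    by rewrite -rmorphXn sqrtCK rmorph_nat.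
  have -> : u x = ratr a + ratr b * u (sqrtC d%:R).
    by rewrite xE rmorphD (rmorphM u (ratr b)) (aut_Crat u (Crat_rat a)) (aut_Crat u (Crat_rat b)).
  rewrite eqf_sqr => /orP[] /eqP ->; first by exists a, b.
  by exists a, (- b); rewrite rmorphN mulNr mulrN.
- by rewrite rmorph1; apply: Rcomp_one.
- by rewrite rmorphD; apply: Rcomp_add.
- by rewrite rmorphN; apply: Rcomp_opp.
- by rewrite rmorphM; apply: Rcomp_mul.
Qed.

Lemma in_Rcomp_frob (p : nat) x : prime p -> in_Rcomp x ->
  (x ^+ (p ^ 3) == x ^+ p %[mod p])%A.
Proof.
move=> pp; elim=> {x} [d x _ _ [[a [b xE]] xA]||x y Rx xF Ry yF|x _ xF|x y Rx xF Ry yF].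
(* The rational quadratic has the trace 2a and the norm a^2 - d b^2 of x = a + b sqrt d as
   coefficients. *)
- have x2 : x ^+ 2 = ratr (2 * a) * x - ratr (a ^+ 2 - b ^+ 2 * d%:R).
    have -> : ratr (2 * a) = 2 * ratr a :> algC by rewrite rmorphM /= ratr_nat.
    have -> : ratr (a ^+ 2 - b ^+ 2 * d%:R) =
        ratr a ^+ 2 - ratr b ^+ 2 * sqrtC d%:R ^+ 2 :> algC.
      by rewrite rmorphB rmorphXn (rmorphM _ (b ^+ 2)) rmorphXn /= ratr_nat sqrtCK.
    by rewrite xE; ring.
  have [t [m [tZ mZ {}x2]]] := quadratic_Aint_coefs xA x2.
  have [p2|podd] := even_prime pp; last exact: quadratic_frob_odd tZ mZ xA x2.
  by rewrite p2; apply: quadratic_frob2 tZ mZ xA x2.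
- by rewrite !expr1n eqAmod_refl.
- have xA := in_Rcomp_Aint Rx; have yA := in_Rcomp_Aint Ry.
  apply: eqAmod_trans (eqAmodXD 3 pp xA yA) _.
  rewrite eqAmod_sym; have := eqAmodXD 1 pp xA yA; rewrite expn1 => /eqAmod_trans; apply.
  by rewrite eqAmod_sym eqAmodD.
- rewrite -mulN1r !exprMn -signr_odd oddX /= -[in X in (_ == X %[mod _])%A]signr_odd.
  by rewrite eqAmodMl // rpredX // rpredN rpred1.
- by rewrite !exprMn eqAmodM // rpredX // in_Rcomp_Aint.
Qed.

(* The Frobenius congruence becomes an equality: the quotient of the difference
   by [p > 4] is an algebraic integer all of whose conjugates have absolute
   value at most [4 / p < 1]. *)
Lemma unit_circle_frob (p : nat) (z : algC) : prime p -> (4 < p)%N ->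
  z \in Aint -> (forall u, `|u z| = 1) -> in_Rcomp (z + z^-1) ->
  z ^+ (p ^ 3 - p) = 1 \/ z ^+ (p ^ 3 + p) = 1.
Proof.
move=> pp p4 zA z1 Ra.
have z0 : z != 0 by rewrite -normr_gt0 (z1 idfun) ltr01.
have zVA : z^-1 \in Aint.
  have -> : z^-1 = (z + z^-1) - z by ring.
  by rewrite rpredB // in_Rcomp_Aint.
set q := (p ^ 3)%N.
have pq : (p <= q)%N by rewrite /q -{1}(expn1 p) leq_pexp2l ?prime_gt0.
have cong : (z ^+ q + z^-1 ^+ q == z ^+ p + z^-1 ^+ p %[mod p])%A.
  have := eqAmodXD 3 pp zA zVA; rewrite eqAmod_sym => /eqAmod_trans; apply.
  apply: eqAmod_trans (in_Rcomp_frob pp Ra) _.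
  by have := eqAmodXD 1 pp zA zVA; rewrite expn1.
move: cong; rewrite eqAmod_nat_div ?prime_gt0 // => /Aint_conj_lt1_eq0 y0.
have p0 : p%:R != 0 :> algC by rewrite pnatr_eq0 -lt0n prime_gt0.
have : z ^+ q + z^-1 ^+ q - (z ^+ p + z^-1 ^+ p) = 0.
  apply: (mulIf (invr_neq0 p0)); rewrite mul0r; apply: y0 => u.
  rewrite fmorph_div rmorph_nat normrM normfV normr_nat ltr_pdivrMr ?ltr0n ?prime_gt0 //.
  rewrite mul1r; apply: (@le_lt_trans _ _ 4); last by rewrite (ltr_nat _ 4).
  have nX k : `|u z ^+ k| = 1 by rewrite normrX z1 expr1n.
  have nVX k : `|(u z)^-1 ^+ k| = 1 by rewrite normrX normfV z1 invr1 expr1n.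
  rewrite rmorphB !rmorphD !rmorphXn /= fmorphV.
  apply: le_trans (ler_normB _ _) _.
  have le2 k : `|u z ^+ k + (u z)^-1 ^+ k| <= 2.
    by apply: le_trans (ler_normD _ _) _; rewrite nX nVX.
  by apply: le_trans (lerD (le2 _) (le2 _)) _; rewrite -natrD.
(* The difference of the two traces factors, so its vanishing makes [z] a root of unity. *)
have -> : z ^+ q + z^-1 ^+ q - (z ^+ p + z^-1 ^+ p) =
    z^-1 ^+ q * (z ^+ (q - p) - 1) * (z ^+ (q + p) - 1).
  have zk k : z ^+ k != 0 by rewrite expf_neq0.
  have zq : z ^+ q = z ^+ (q - p) * z ^+ p by rewrite -exprD subnK.
  rewrite !exprVn exprD zq; move: (zk p) (zk (q - p)%N).
  by move: (z ^+ p) (z ^+ (q - p)) => b c b0 c0; field; rewrite b0 c0.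
move/eqP; rewrite !mulf_eq0 expf_eq0 invr_eq0 (negPf z0) andbF /= !subr_eq0.
by case/orP=> /eqP; [left|right].
Qed.

(** The conjugate of [z] is a root of X^2 - (z + 1/z) X + 1, hence equals [z] or 1/z. The second
    case is the claim; in the first [z] is real, and (z - 1/z)^2 = (z + 1/z)^2 - 4 is both
    nonnegative and nonpositive. *)
Lemma norm1_of_real_trace z : z != 0 -> z + z^-1 \is Num.real ->
  (z + z^-1) ^+ 2 <= 4 -> `|z| = 1.
Proof.
move=> z0 aR a4; apply/eqP; rewrite -sqrp_eq1 ?normr_ge0 // normCK.
have : (z^* - z) * (z^* - z^-1) == 0.
  have /CrealP := aR; rewrite rmorphD fmorphV /= => zE.
  have -> : (z^* - z) * (z^* - z^-1) =
      z^* * (z^* + z^*^-1 - (z + z^-1)) - (z^* / z^* - z / z) by ring.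
  by rewrite zE subrr mulr0 !mulfV ?subrr ?conjC_eq0.
rewrite mulf_eq0 !subr_eq0 => /orP[] /eqP zE; last by rewrite zE mulfV.
have zR : z \is Num.real by apply/CrealP.
have d2 : (z - z^-1) ^+ 2 = (z + z^-1) ^+ 2 - 4 by field.
have /eqP : (z - z^-1) ^+ 2 = 0.
  apply/le_anti; rewrite real_exprn_even_ge0 ?rpredB ?rpredV // andbT.
  by rewrite d2 subr_le0.
by rewrite expf_eq0 /= subr_eq0 zE => /eqP {1}->; rewrite mulVf.
Qed.

Lemma Aint_quadratic_root a z : a \in Aint -> z ^+ 2 = a * z - 1 -> z \in Aint.
Proof.
have intA x : integralOver (intr : int -> algC) x <-> x \in Aint.
  split=> [[p mon_p px]|].
    apply: (root_monic_Aint px); first exact: monic_map.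
    by apply/polyOverP=> i; rewrite coef_map rpred_int.
  rewrite unfold_in => /floorpP[p Dp]; exists p; last by rewrite -Dp root_minCpoly.
  have := minCpoly_monic x; rewrite Dp !monicE lead_coef_map_inj //.
    by rewrite -[X in _ == X]/(1%:~R) eqr_int.
  exact: intr_inj.
move=> aA zE; apply/intA.
have szp : size ('X^2 + (1 - a *: 'X) : {poly algC}) = 3%N.
  rewrite size_polyDl size_polyXn // (leq_ltn_trans (size_polyD _ _)) // gtn_max size_polyN.
  by rewrite size_poly1 (leq_ltn_trans (size_scale_leq _ _)) ?size_polyX.
apply: (@integral_root_monic _ _ _ _ ('X^2 + (1 - a *: 'X))).
- by rewrite monicE lead_coefE szp !coefE /= mulr0 subr0 addr0.
- by rewrite rootE -polyC1 !(hornerD, hornerN, hornerZ, hornerX, hornerXn, hornerC) zE; apply/eqP; ring.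
apply/integral_poly => -[|[|[|i]]]; rewrite !coefE /= ?mulr0 ?mulr1 ?subr0 ?addr0 ?add0r; apply/intA.
- exact: rpred1.
- by rewrite ?sub0r rpredN.
- exact: rpred1.
exact: rpred0.
Qed.

(** The exponents p^3 - p and p^3 + p are 120 and 130 for p = 5, and 336 and 350 for p = 7. The four
    gcds are 24, 10, 2 and 10. *)
Lemma Rcomp_unit_circle_order z : z \in Aint -> (forall u, `|u z| = 1) ->
  in_Rcomp (z + z^-1) -> z ^+ 24 = 1 \/ z ^+ 10 = 1.
Proof.
move=> zA z1 Rz.
have ord (m k d : nat) : (gcdn m k %| d)%N -> z ^+ m = 1 -> z ^+ k = 1 -> z ^+ d = 1.
  move=> dv /eqP; rewrite -dvdn_orderC => zm /eqP; rewrite -dvdn_orderC => zk.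
  by apply/eqP; rewrite -dvdn_orderC (dvdn_trans _ dv) // dvdn_gcd zm.
have [F5|F5] := unit_circle_frob (isT : prime 5) isT zA z1 Rz;
  have [F7|F7] := unit_circle_frob (isT : prime 7) isT zA z1 Rz.
- by left; apply: ord F5 F7.
- by right; apply: ord F5 F7.
- by right; apply: ord F5 F7.
- by right; apply: ord F5 F7.
Qed.

Lemma half_three_notin_Aint : (3 / 2 : algC) \notin Aint.
Proof.
apply/negP=> /(Cint_rat_Aint _) H.
have /intrP[m mE] : (3 / 2 : algC) \in Num.int.
  by apply: H; rewrite rpred_div ?rpred_nat.
have : (m * 2)%:~R = 3%:~R :> algC by rewrite intrM -mE; field.
by move/intr_inj; lia.
Qed.

(** The roots of this quartic are the traces z + 1/z of the elements [z] of order 24. They are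
    algebraic integers, but the congruence at p = 2 would make y = (a^2 + 1)/2 one too, and then 3y
    - y^2 = 3/2. *)
Lemma Rcomp_not_2cos15 a : in_Rcomp a -> a ^+ 4 - 4 * a ^+ 2 + 1 != 0.
Proof.
move=> Ra; apply: contra half_three_notin_Aint => /eqP a4.
have aA := in_Rcomp_Aint Ra.
have := in_Rcomp_frob (isT : prime 2) Ra; rewrite eqAmod_nat_div // => H8.
have yA : (a ^+ 2 + 1) / 2 \in Aint.
  (* Dividing a^8 by the quartic leaves 56 a^2 - 15, so (a^8 - a^2)/2 differs from (a^2 + 1)/2 by 27
     a^2 - 8. *)
  have -> : (a ^+ 2 + 1) / 2 = (a ^+ 8 - a ^+ 2) / 2 - (27 * a ^+ 2 - 8) -
      (a ^+ 4 - 4 * a ^+ 2 + 1) * (a ^+ 4 + 4 * a ^+ 2 + 15) / 2 by field.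
  by rewrite a4 mul0r mul0r subr0 !(rpredB H8) // rpredB ?rpredM ?rpredX ?rpred_nat.
have -> : 3 / 2 = 3 * ((a ^+ 2 + 1) / 2) - ((a ^+ 2 + 1) / 2) ^+ 2 +
    (a ^+ 4 - 4 * a ^+ 2 + 1) / 4 :> algC by field.
rewrite a4 mul0r addr0; move: yA; set y := (_ / 2) => yA.
by rewrite rpredB ?(rpredX 2 yA) ?(rpredM (rpred_nat _ 3) yA).
Qed.

Lemma Rcomp_small_cases a : in_Rcomp a -> (forall u, u a ^+ 2 <= 4) ->
  [\/ a \in Num.int, a ^+ 2 = 2, a ^+ 2 = 3 | a ^+ 4 - 3 * a ^+ 2 + 1 = 0].
Proof.
move=> Ra a4; pose z := (a + sqrtC (a ^+ 2 - 4)) / 2.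
have z2 : z ^+ 2 = a * z - 1.
  have -> : z ^+ 2 = a * z - (a ^+ 2 - sqrtC (a ^+ 2 - 4) ^+ 2) / 4 by rewrite /z; field.
  by rewrite sqrtCK; field.
have z0 : z != 0 by apply: contra_eq_neq z2 => ->; rewrite expr0n mulr0 sub0r eq_sym oppr_eq0 oner_eq0.
have aE : a = z + z^-1.
  by apply: (mulIf z0); rewrite mulrDl mulVf // -expr2 z2 subrK.
have zA : z \in Aint := Aint_quadratic_root (in_Rcomp_Aint Ra) z2.
have z1 u : `|u z| = 1.
  apply: norm1_of_real_trace; first by rewrite fmorph_eq0.
    by rewrite -fmorphV -rmorphD -aE; apply/in_Rcomp_real/in_Rcomp_aut.
  by rewrite -fmorphV -rmorphD -aE.
have Rz : in_Rcomp (z + z^-1) by rewrite -aE.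
have int_n (e : algC) (m : int) : a - e = 0 -> e = m%:~R -> a \in Num.int.
  by move=> /eqP; rewrite subr_eq0 => /eqP -> ->; apply: rpred_int.
(* Dividing a palindromic polynomial in [z] by its middle power turns it into a polynomial in a = z
   + 1/z. *)
have cancel k (e P : algC) : P = 0 -> e * z ^+ k = P -> e = 0.
  by move=> -> /eqP; rewrite mulf_eq0 expf_eq0 (negPf z0) andbF orbF => /eqP.
have F2 : z ^+ 2 - 1 = 0 -> a \in Num.int.
  move=> H; have /eqP : (a - 2) * (a + 2) = (z ^+ 2 - 1) ^+ 2 / z ^+ 2.
    by rewrite aE; field.
  rewrite H expr0n mul0r mulf_eq0 => /orP[] /eqP; first by move/(int_n _ 2); apply.
  by rewrite -[X in a + X]opprK => /(int_n _ (-2)); apply.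
have [z24|z10] := Rcomp_unit_circle_order zA z1 Rz.
  (* The factors of z^24 - 1 are cyclotomic polynomials, with orders 1 and 2 merged; the others have
     orders 3, 6, 4, 12, 8 and 24. *)
  have : (z ^+ 2 - 1) * (z ^+ 2 + z + 1) * (z ^+ 2 - z + 1) * (z ^+ 2 + 1) *
      (z ^+ 4 - z ^+ 2 + 1) * (z ^+ 4 + 1) * (z ^+ 8 - z ^+ 4 + 1) == 0.
    by apply/eqP; rewrite -(subrr (1 : algC)) -[X in _ = X - _]z24; ring.
  rewrite !mulf_eq0 -!orbA => /or4P[|||/or4P[]] /eqP H.
  - by constructor 1; apply: F2.
  - constructor 1; apply: (int_n (-1) (-1)) => //.
    by apply: (cancel 1%N) H _; rewrite aE; field.
  - constructor 1; apply: (int_n 1 1) => //.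
    by apply: (cancel 1%N) H _; rewrite aE; field.
  - constructor 1; apply: (int_n 0 0) => //.
    by apply: (cancel 1%N) H _; rewrite aE; field.
  - constructor 3; apply/eqP; rewrite -subr_eq0; apply/eqP.
    by apply: (cancel 2%N) H _; rewrite aE; field.
  - constructor 2; apply/eqP; rewrite -subr_eq0; apply/eqP.
    by apply: (cancel 2%N) H _; rewrite aE; field.
  case/eqP: (Rcomp_not_2cos15 Ra).
  by apply: (cancel 4%N) H _; rewrite aE; field.
have : (z ^+ 2 - 1) * (z ^+ 4 + z ^+ 3 + z ^+ 2 + z + 1) *
    (z ^+ 4 - z ^+ 3 + z ^+ 2 - z + 1) == 0.
  by apply/eqP; rewrite -(subrr (1 : algC)) -[X in _ = X - _]z10; ring.
rewrite !mulf_eq0 -!orbA => /or3P[] /eqP H; first by constructor 1; apply: F2.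
  have aa : a ^+ 2 + a - 1 = 0 by apply: (cancel 2%N) H _; rewrite aE; field.
  constructor 4; rewrite -(mul0r (a ^+ 2 - a - 1)) -aa; ring.
have aa : a ^+ 2 - a - 1 = 0 by apply: (cancel 2%N) H _; rewrite aE; field.
constructor 4; rewrite -(mul0r (a ^+ 2 + a - 1)) -aa; ring.
Qed.

End RcompEntries.

(** * Automorphisms changing the sign of exactly one of sqrt 2, sqrt 3, sqrt 5 *)

Lemma sqrt_sign_aut (b2 b3 b5 : bool) : (b2, b3, b5) \in
  [:: (true, false, false); (false, true, false); (false, false, true)] ->
  exists u : {rmorphism algC -> algC}, forall x,
    [/\ x ^+ 2 = 2 -> u x = (-1) ^+ b2 * x, x ^+ 2 = 3 -> u x = (-1) ^+ b3 * x
      & x ^+ 2 = 5 -> u x = (-1) ^+ b5 * x].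
Proof.
have [z prim_z] := C_prim_root_exists (isT : (0 < 120)%N).
have z120 : z ^+ 120 = 1 := prim_expr_order prim_z.
have zmod j k : (j = k %[mod 120])%N -> z ^+ j = z ^+ k.
  by move=> jk; rewrite -(prim_expr_mod prim_z) jk prim_expr_mod.
have zneq1 j : ~~ (120 %| j)%N -> z ^+ j != 1.
  by apply: contra => zj; rewrite (prim_order_dvd prim_z) zj.
have z60 : z ^+ 60 = -1.
  have : (z ^+ 60 - 1) * (z ^+ 60 + 1) == 0 by rewrite -subr_sqr_1 -exprM z120 subrr.
  rewrite mulf_eq0 subr_eq0 (negPf (zneq1 60%N isT)) /= addr_eq0 => /eqP //.
have zN j k : (j = 60 + k %[mod 120])%N -> z ^+ j = - z ^+ k.
  by move/zmod ->; rewrite exprD z60 mulN1r.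
(* The three roots inside the field of 120th roots of unity: twice the cosines of 45 and 30 degrees
   up to conjugation, and the quadratic Gauss sum for 5. *)
pose s2 := z ^+ 15 + z ^+ 105; pose s3 := z ^+ 10 + z ^+ 110.
pose w := z ^+ 24; pose s5 := 1 + 2 * (w + w ^+ 4).
have w5 : 1 + w + w ^+ 2 + w ^+ 3 + w ^+ 4 = 0.
  have /eqP : (w - 1) * (1 + w + w ^+ 2 + w ^+ 3 + w ^+ 4) = w ^+ 5 - 1 by ring.
  by rewrite -[w ^+ 5]exprM z120 subrr mulf_eq0 subr_eq0 (negPf (zneq1 24%N isT)) => /eqP.
have s2E : s2 ^+ 2 = 2.
  have -> : s2 ^+ 2 = z ^+ 30 + 2 * z ^+ 120 + z ^+ 210 by rewrite /s2; ring.
  by rewrite z120 (@zN 210 30) // mulr1 addrAC subrr add0r.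
have s3E : s3 ^+ 2 = 3.
  have -> : s3 ^+ 2 = z ^+ 20 + 2 * z ^+ 120 + z ^+ 220 by rewrite /s3; ring.
  have z20 : (z ^+ 20) ^+ 2 - z ^+ 20 + 1 = 0.
    have /eqP : (z ^+ 20 + 1) * ((z ^+ 20) ^+ 2 - z ^+ 20 + 1) = z ^+ 60 + 1 by ring.
    rewrite z60 addNr mulf_eq0 addr_eq0 => /orP[/eqP z20|/eqP //].
    by have := zneq1 40%N isT; rewrite (exprM z 20 2) z20 sqrrN expr1n eqxx.
  rewrite z120 (@zN 220 40) // (exprM z 20 2).
  by rewrite -[RHS]subr0 -z20; ring.
have s5E : s5 ^+ 2 = 5.
  have -> : s5 ^+ 2 = 1 + 4 * (w + w ^+ 4) + 4 * (w ^+ 2 + 2 * w ^+ 5 + w ^+ 5 * w ^+ 3).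
    by rewrite /s5; ring.
  rewrite -[w ^+ 5]exprM z120.
  by rewrite -[RHS]addr0 -[0 in RHS](mulr0 4) -w5; ring.
have fin (u : {rmorphism algC -> algC}) : u s2 = (-1) ^+ b2 * s2 ->
    u s3 = (-1) ^+ b3 * s3 -> u s5 = (-1) ^+ b5 * s5 -> forall x,
    [/\ x ^+ 2 = 2 -> u x = (-1) ^+ b2 * x, x ^+ 2 = 3 -> u x = (-1) ^+ b3 * x
      & x ^+ 2 = 5 -> u x = (-1) ^+ b5 * x].
  have gen (s c : algC) (b : bool) x : u s = (-1) ^+ b * s -> s ^+ 2 = c -> x ^+ 2 = c ->
      u x = (-1) ^+ b * x.
    move=> us <- /eqP; rewrite eqf_sqr => /orP[] /eqP -> //.
    by rewrite rmorphN us mulrN.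
  by move=> u2 u3 u5 x; split; [apply: gen u2 s2E | apply: gen u3 s3E | apply: gen u5 s5E].
have aut k : coprime k 120 -> exists u : {rmorphism algC -> algC}, forall j, u (z ^+ j) = z ^+ (j * k).
  move=> ck; have [u uE] := Qn_aut_exists ck; exists u => j.
  by rewrite uE -?exprM // mulnC exprM z120 expr1n.
have u2E (u : {rmorphism algC -> algC}) : u s2 = u (z ^+ 15) + u (z ^+ 105) by rewrite -rmorphD.
have u3E (u : {rmorphism algC -> algC}) : u s3 = u (z ^+ 10) + u (z ^+ 110) by rewrite -rmorphD.
have u5E (u : {rmorphism algC -> algC}) : u s5 = 1 + 2 * (u (z ^+ 24) + u (z ^+ 96)).
  by rewrite rmorphD rmorph1 rmorphM rmorph_nat rmorphD /w -exprM.
(* The exponents come from the Chinese remainder theorem: 61 is 5 modulo 8 and 1 modulo 15; 41 is 2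
   modulo 3 and 1 modulo 40; 97 is 2 modulo 5 and 1 modulo 24. *)
rewrite !inE => /or3P[] /eqP[b2E b3E b5E].
- have [u uE] := aut 61%N isT; exists u; apply: fin.
  + by rewrite u2E !uE b2E (@zN (15 * 61) 15) // (@zN (105 * 61) 105) // /= ?expr1 mulN1r opprD.
  + by rewrite u3E !uE b3E (@zmod (10 * 61) 10) // (@zmod (110 * 61) 110) // /= ?expr0 mul1r.
  + by rewrite u5E !uE b5E (@zmod (24 * 61) 24) // (@zmod (96 * 61) 96) // /= ?expr0 mul1r /s5 /w -exprM.
- have [u uE] := aut 41%N isT; exists u; apply: fin.
  + by rewrite u2E !uE b2E (@zmod (15 * 41) 15) // (@zmod (105 * 41) 105) // /= ?expr0 mul1r.
  + by rewrite u3E !uE b3E (@zN (10 * 41) 110) // (@zN (110 * 41) 10) // /= ?expr1 mulN1r opprD addrC.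
  + by rewrite u5E !uE b5E (@zmod (24 * 41) 24) // (@zmod (96 * 41) 96) // /= ?expr0 mul1r /s5 /w -exprM.
have [u uE] := aut 97%N isT; exists u; apply: fin.
- by rewrite u2E !uE b2E (@zmod (15 * 97) 15) // (@zmod (105 * 97) 105) // /= ?expr0 mul1r.
- by rewrite u3E !uE b3E (@zmod (10 * 97) 10) // (@zmod (110 * 97) 110) // /= ?expr0 mul1r.
rewrite u5E !uE b5E (@zmod (24 * 97) (24 * 2)) // (@zmod (96 * 97) (24 * 3)) // !exprM -/w /= ?expr1 mulN1r.
apply/eqP; rewrite -addr_eq0 /s5; apply/eqP.
by rewrite -[RHS](mulr0 2) -w5; ring.
Qed.

(** * Paths between heavy edges *)

Section Defect.
Context {R : realFieldType} {n : nat}.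
Implicit Types (B : 'M[R]_n) (x y : 'I_n -> R).

(** Its nonnegativity is the bilinear form of the operator norm bound 2, as 2|x||y| is at most |x|^2
    + |y|^2. *)
Definition defect B x y : R :=
  \sum_i x i ^+ 2 + \sum_i y i ^+ 2 - \sum_i \sum_j x i * B i j * y j.

Definition bump_at y r c : 'I_n -> R := fun i => y i + (if i == r then c else 0).

Lemma defectC B x y : B^T = B -> defect B x y = defect B y x.
Proof.
move=> Bsym; rewrite /defect [X in X - _]addrC; congr (_ - _).
rewrite exchange_big; apply: eq_bigr => i _; apply: eq_bigr => j _.
have -> : B j i = B i j by rewrite -{1}Bsym mxE.
by ring.
Qed.

Lemma defect_bump B x y r c : y r = 0 ->
  defect B x (bump_at y r c) =
  defect B x y + c ^+ 2 - c * \sum_i x i * B i r.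
Proof.
move=> yr0; rewrite /defect.
have -> : \sum_i bump_at y r c i ^+ 2 = \sum_i y i ^+ 2 + c ^+ 2.
  rewrite (bigD1 r) //= [in RHS](bigD1 r) //= /bump_at eqxx yr0 add0r expr0n add0r.
  rewrite addrC; congr (_ + _); apply: eq_bigr => i /negPf ->.
  by rewrite addr0.
have -> : \sum_i \sum_j x i * B i j * bump_at y r c j =
    \sum_i \sum_j x i * B i j * y j + c * \sum_i x i * B i r.
  rewrite mulr_sumr -big_split /=; apply: eq_bigr => i _.
  rewrite (bigD1 r) //= [in RHS](bigD1 r) //= /bump_at eqxx yr0 add0r mulr0 add0r.
  rewrite addrC [c * _]mulrC; congr (_ + _); apply: eq_bigr => j /negPf ->.
  by rewrite addr0.
by ring.
Qed.

Lemma defect_delta B v : defect B (bump_at (fun=> 0) v 1) (fun=> 0) = 1.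
Proof.
rewrite /defect; have -> : \sum_(i < n) (0 : R) ^+ 2 = 0.
  by rewrite big1 // => i _; rewrite expr0n.
have -> : \sum_i \sum_j bump_at (fun=> 0) v 1 i * B i j * 0 = 0.
  by rewrite big1 // => i _; rewrite big1 // => j _; rewrite mulr0.
rewrite (bigD1 v) //= big1 => [|i /negPf iv]; rewrite /bump_at ?iv ?eqxx /=; ring.
Qed.

End Defect.

Section Layers.
Context {n : nat}.
Variables (e : rel 'I_n) (T : {set 'I_n}).

(* [layer k.+1] is the ball of radius [k] around [T]; [layer 0] is empty. *)
Fixpoint layer (k : nat) : {set 'I_n} :=
  if k is k'.+1
  then T :|: layer k' :|: [set v | [exists w in layer k', e w v]]
  else set0.

Lemma layer1 : layer 1 = T.
Proof.
apply/setP=> v; rewrite /= !inE orbF; case: (v \in T) => //=.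
by apply/existsP=> -[w]; rewrite inE.
Qed.

Lemma layerS k : layer k \subset layer k.+1.
Proof. by apply/subsetP=> v vk; rewrite !inE vk orbT. Qed.

Lemma layer_mono j k : (j <= k)%N -> layer j \subset layer k.
Proof.
move=> /subnK <-; elim: (k - j)%N => [|m IH]; first by [].
exact: subset_trans IH (layerS _).
Qed.

Lemma layer_edge k w v : w \in layer k -> e w v -> v \in layer k.+1.
Proof.
move=> wk ev; rewrite !inE; apply/orP; right.
by apply/existsP; exists w; rewrite wk.
Qed.

Lemma layer_pred k v : v \in layer k.+2 -> v \notin layer k.+1 ->
  exists2 w, w \in layer k.+1 :\: layer k & e w v.
Proof.
move=> vk2 vk1; suff [w wk1 ev] : exists2 w, w \in layer k.+1 & e w v.
  exists w => //; rewrite inE wk1 andbT.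
  by apply: contra vk1 => wk; apply: layer_edge wk ev.
move: vk2; rewrite [layer k.+2]/= -/(layer k.+1) in_setU in_setU.
rewrite (negPf vk1) orbF => /orP[vT|]; last first.
  by rewrite inE => /existsP[w /andP[]]; exists w.
by move: vk1; rewrite /= !inE vT.
Qed.

Lemma layer_connect v w : v \in T -> connect e v w -> exists k, w \in layer k.
Proof.
move=> vT /connectP[p]; rewrite -layer1 in vT.
elim: p v 1%N vT => [|u p IH] v k vk /=; first by move=> _ ->; exists k.
by case/andP=> ev pp lw; apply: (IH u k.+1) => //; apply: layer_edge vk ev.
Qed.

(** The least layer meeting [S] is taken. It is not the empty layer 0, which explains the shift; k =
    0 means that [T] itself meets [S]. *)
Lemma first_meeting (S : {set 'I_n}) v w : v \in T -> w \in S -> connect e v w ->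
  exists k, exists2 u, u \in S :&: layer k.+1 & [disjoint layer k & S].
Proof.
move=> vT wS cvw.
have ex : exists k, [exists u, u \in S :&: layer k].
  by have [k wk] := layer_connect vT cvw; exists k; apply/existsP; exists w; rewrite inE wS.
case: (ex_minnP ex) => -[|k] /existsP[u uk] kmin; first by move: uk; rewrite !inE andbF.
exists k, u => //; rewrite disjoint_sym; apply/pred0P => z /=.
apply/negP=> /andP[zS zk]; have /kmin : [exists u, u \in S :&: layer k].
  by apply/existsP; exists z; rewrite inE zS.
by rewrite ltnn.
Qed.

End Layers.

Lemma sgr_sqr_mul (R : realFieldType) (a : R) : a != 0 -> Num.sg a ^+ 2 = 1 /\ Num.sg a * a = `|a|.
Proof. by move=> a0; rewrite sqr_sg a0 normrEsg. Qed.

Lemma normr_ge1_sqr (R : realFieldType) (a : R) : 1 <= a ^+ 2 -> 1 <= `|a|.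
Proof. by move=> a1; rewrite -(@ler_pXn2r _ 2) ?nnegrE ?normr_ge0 // expr1n real_normK ?num_real. Qed.

(** * A heavy row and a row of another irrationality cannot be joined *)

Section NoMixing.
Context {R : realFieldType} {n : nat}.
(** In the application [T] holds the rows with an entry of square 2 (or 3), [S] the rows with a
    different irrational entry, and [B'] is the conjugate of [B] under an automorphism negating that
    square root. *)
Variables (e : rel 'I_n) (T S : {set 'I_n}) (B B' : 'M[R]_n).
Hypothesis Bsym : B^T = B.
Hypothesis B'sym : B'^T = B'.
Hypothesis B_ge0 : forall x y, 0 <= defect B x y.
Hypothesis B'_ge0 : forall x y, 0 <= defect B' x y.
Hypothesis edge_neq0 : forall w v, e w v -> B w v != 0.
Hypothesis neq0_edge : forall w v, w != v -> B w v != 0 -> e w v.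
Hypothesis T_heavy : forall w, w \in T ->
  exists2 q, q \in T & 2 <= B w q ^+ 2 /\ B' w q = - B w q.
Hypothesis light_ge1 : forall w v, w \notin S -> B w v != 0 -> 1 <= B w v ^+ 2.
Hypothesis light_eq : forall w v, w \notin S -> v \notin T -> B' w v = B w v.

Let L := layer e T.

Let non_edge k w v : w \in L k -> v \notin L k.+1 -> B w v = 0.
Proof.
move=> wk vk1; apply/eqP; apply: contraNT vk1 => Bwv.
have [<-|wv] := eqVneq w v; first by apply: (subsetP (layerS _ _ _)).
by apply: layer_edge wk _; apply: neq0_edge.
Qed.

Let L1 : L 1 = T. Proof. exact: layer1. Qed.

Let sum_row x (v w : 'I_n) (M : 'M[R]_n) :
  (forall i, i != w -> x i * M i v = 0) -> \sum_i x i * M i v = x w * M w v.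
Proof. by move=> H; rewrite (bigD1 w) //= big1 ?addr0. Qed.

(** The partner [q] of the starting row lies in [T], so the supports never shrink below layer 1. *)
Let M j := L (maxn 1 j).

Let M_S j : M j.+1 = L j.+1. Proof. by rewrite /M (maxn_idPr _). Qed.

(* The Schur complement of [2 - A] along a path that starts with a heavy edge
   stays at most 1/2: this is the computation showing that the diagrams of
   type B are positive definite. *)
Lemma path_vector j w : w \in L j.+1 -> w \notin L j -> [disjoint L j & S] ->
  exists x y, [/\ defect B x y <= 2^-1, x w ^+ 2 = 1,
    forall i, i != w -> (j == 0%N) || (i \notin M j.-1) -> x i = 0
    & forall i, i \notin M j -> y i = 0].
Proof.
elim: j w => [|j IH] w wj wj' djS.
  rewrite L1 in wj; have [q qT [Bq2 _]] := T_heavy wj.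
  (* With b = B w q the defect is 1 + 1/b^2 - 1, at most 1/2 because b^2 is at least 2. *)
  exists (bump_at (fun=> 0) w 1), (bump_at (fun=> 0) q (B w q)^-1).
  have Bq0 : B w q != 0 by apply: contraTneq Bq2 => ->; rewrite expr0n /= lern0.
  split.
  - rewrite defect_bump // defect_delta (sum_row (w := w)).
      rewrite /bump_at eqxx add0r mul1r mulVf // exprVn addrAC subrr add0r.
      by rewrite lef_pV2 ?posrE ?(lt_le_trans _ Bq2).
    by move=> i iw; rewrite /bump_at (negPf iw) addr0 mul0r.
  - by rewrite /bump_at eqxx add0r expr1n.
  - by move=> i iw _; rewrite /bump_at (negPf iw) addr0.
  move=> i; rewrite /M L1 => iT; rewrite /bump_at ifN ?addr0 //.
  by apply: contraNneq iT => ->.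
have [u] := layer_pred wj wj'; rewrite inE => /andP[uj' uj] euw.
have djS' : [disjoint L j & S].
  by apply: disjointWl djS; apply: layerS.
have [x [y [Qxy xu2 xsupp ysupp]]] := IH u uj uj' djS'.
have uS : u \notin S by rewrite (disjointFr djS uj).
have Buw := edge_neq0 euw.
have aw : \sum_i x i * B i w = x u * B u w.
  apply: sum_row => i iu; have [j0|j0] := eqVneq j 0%N.
    by rewrite xsupp ?mul0r ?j0.
  have [iM|iM] := boolP (i \in M j.-1); last by rewrite xsupp ?iM ?orbT ?mul0r.
  rewrite (@non_edge j) ?mulr0 //; apply: subsetP iM.
  by apply: layer_mono; rewrite geq_max lt0n j0 leq_pred.
have yw : y w = 0.
  apply: ysupp; apply: contra wj'; apply: subsetP; apply: layer_mono.
  by rewrite geq_max leqnSn.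
have a0 : x u * B u w != 0.
  by rewrite mulf_neq0 // -sqrf_eq0 xu2 oner_eq0.
have a1 : 1 <= `|x u * B u w|.
  by apply: normr_ge1_sqr; rewrite exprMn xu2 mul1r; apply: light_ge1.
have [s2 sa] := sgr_sqr_mul a0.
(* The two vectors swap roles, so consecutive path vertices lie in different vectors. The new
   coordinate adds 1 and removes the absolute value of [x u * B u w], which is at least 1. *)
exists (bump_at y w (Num.sg (x u * B u w))), x; split.
- rewrite defectC // defect_bump // aw s2 sa; lra.
- by rewrite /bump_at eqxx yw add0r.
- move=> i iw; rewrite /= => iM; rewrite /bump_at (negPf iw) addr0.
  exact: ysupp.
move=> i; rewrite M_S => iM; apply: xsupp.
  by apply: contraNneq iM => ->.
apply/orP; right; apply: contra iM; apply: subsetP; apply: layer_mono.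
by rewrite geq_max /= (leq_trans (leq_pred _) (leqnSn _)).
Qed.

Lemma no_mixing k v r : v \in S :&: L k.+1 -> [disjoint L k & S] -> r \in S ->
  2 < B v r ^+ 2 -> B' v r = B v r -> False.
Proof.
rewrite inE => /andP[vS vk] dkS rS Br2 B'r.
have vk' : v \notin L k by apply: contraTN vS => /(disjointFr dkS) ->.
have rk : r \notin L k by apply: contraTN rS => /(disjointFr dkS) ->.
(* The weight b/2 on [r] minimizes the defect, giving Q - b^2/4, negative since Q is at most 1/2 and
   b^2 exceeds 2. *)
have final (b Q : R) : 2 < b ^+ 2 -> Q <= 2^-1 -> Q + (b / 2) ^+ 2 - b / 2 * b < 0.
  move=> b2 Q2; have -> : b / 2 * b = b ^+ 2 / 2 by ring.
  have -> : (b / 2) ^+ 2 = b ^+ 2 / 4 by field.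
  lra.
have cancel (t c d m : R) : 1 <= m -> t ^+ 2 + (c / 2) ^+ 2 - c / 2 * c < 0 ->
    0 <= t ^+ 2 + (1 - m) + (c / 2) ^+ 2 - c / 2 * (t * d + c) +
      (t ^+ 2 + (1 - m) + (c / 2) ^+ 2 - c / 2 * (- t * d + c)) -> False.
  by move=> m1 H1 H2; lra.
have Br0 : B v r != 0 by apply: contraTneq Br2 => ->; rewrite expr0n /= ltrn0.
(* At distance 0 the test vector starts and ends at [v]. At distance 1 a chord from [q] to [r] may
   occur. At larger distance [r] is too far from the rest of the support for a chord. *)
case: k => [|[|k]] in vk vk' rk dkS.
- rewrite L1 in vk; have [q _ [Bq2 B'q]] := T_heavy vk.
  have Bq0 : B v q != 0 by apply: contraTneq Bq2 => ->; rewrite expr0n /= lern0.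
  (* [B'] negates the nonzero entry at [q] but keeps the nonzero one at [r]. *)
  have rq : r != q.
    by apply: contraNneq Br0 => rq; move: B'r; rewrite rq B'q => E; apply/eqP; lra.
  pose x := bump_at (fun=> 0 : R) v 1.
  have rowx i : \sum_j x j * B j i = B v i.
    rewrite (sum_row (w := v)) /x /bump_at ?eqxx ?add0r ?mul1r //.
    by move=> j /negPf->; rewrite addr0 mul0r.
  have := B_ge0 x (bump_at (bump_at (fun=> 0) q (B v q)^-1) r (B v r / 2)).
  rewrite defect_bump; last by rewrite /bump_at (negPf rq) addr0.
  rewrite defect_bump // defect_delta !rowx mulVf // exprVn.
  apply/negP; rewrite -ltNge final // addrAC subrr add0r.
  by rewrite lef_pV2 ?posrE ?(lt_le_trans _ Bq2).
- have [u] := @layer_pred _ e T 0 v vk vk'; rewrite inE => /andP[_ uL1] euv.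
  have uS : u \notin S by rewrite (disjointFr dkS uL1).
  have uT : u \in T by rewrite -L1.
  have vT : v \notin T by rewrite -L1.
  have rT : r \notin T by rewrite -L1.
  have [q qT [Bq2 B'q]] := T_heavy uT.
  have qS : q \notin S by rewrite (disjointFr dkS) // L1.
  have vq : v != q by apply: contraNneq vT => ->.
  have ru : r != u by apply: contraNneq rT => ->.
  have Bq0 : B u q != 0 by apply: contraTneq Bq2 => ->; rewrite expr0n /= lern0.
  have Bv0 := edge_neq0 euv.
  have [s2 sa] := sgr_sqr_mul Bv0; set s := Num.sg (B u v) in s2 sa.
  have a1 : 1 <= `|B u v| by apply: normr_ge1_sqr; apply: light_ge1.
  have b2 : 2 < (s * B v r) ^+ 2 by rewrite exprMn s2 mul1r.
  (* The path is q, u, v, r: the first vector lives on [q] and [v], the second on [u] and [r]. The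
     chord enters only through [t * C q r]. *)
  have value (C : 'M[R]_n) (t : R) : C^T = C -> C u v = B u v -> C v r = B v r ->
      t * C u q = 1 ->
      defect C (bump_at (bump_at (fun=> 0) q t) v s)
               (bump_at (bump_at (fun=> 0) u 1) r (s * B v r / 2)) =
      t ^+ 2 + (1 - `|B u v|) + (s * B v r / 2) ^+ 2 -
      s * B v r / 2 * (t * C q r + s * B v r).
    move=> Csym Cuv Cvr tC.
    rewrite defect_bump; last by rewrite /bump_at (negPf ru) addr0.
    have -> : \sum_i bump_at (bump_at (fun=> 0) q t) v s i * C i r =
        t * C q r + s * B v r.
      rewrite (bigD1 q) //= (bigD1 v) //= big1 => [|i /andP[/negPf iq /negPf iv]].
        by rewrite /bump_at !eqxx (negPf vq) eq_sym (negPf vq) !add0r !addr0 Cvr.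
      by rewrite /bump_at iq iv !addr0 mul0r.
    have rowu i : \sum_j bump_at (fun=> 0) u 1 j * C j i = C u i.
      rewrite (sum_row (w := u)) /bump_at ?eqxx ?add0r ?mul1r //.
      by move=> j /negPf->; rewrite addr0 mul0r.
    rewrite defectC // defect_bump; last by rewrite /bump_at (negPf vq) addr0.
    rewrite rowu defect_bump // defect_delta rowu tC Cuv s2 sa.
    ring.
  have t1 : (B u q)^-1 * B u q = 1 by rewrite mulVf.
  have t1' : - (B u q)^-1 * B' u q = 1 by rewrite B'q mulrNN t1.
  have t2 : (B u q)^-1 ^+ 2 <= 2^-1.
    by rewrite exprVn lef_pV2 ?posrE ?(lt_le_trans _ Bq2).
  (* Negating the [q]-coordinate undoes the sign change of the heavy edge, so
     adding the two inequalities cancels the chord [q r]. *)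
  have := addr_ge0 (B_ge0 _ _) (B'_ge0 _ _).
  move=> /(_ (bump_at (bump_at (fun=> 0) q (B u q)^-1) v s)
    (bump_at (bump_at (fun=> 0) u 1) r (s * B v r / 2))
    (bump_at (bump_at (fun=> 0) q (- (B u q)^-1)) v s)
    (bump_at (bump_at (fun=> 0) u 1) r (s * B v r / 2))).
  rewrite (value B) // (value B') //; last exact: light_eq.
  rewrite light_eq // sqrrN.
  exact: cancel a1 (final _ _ b2 t2).
have [x [y [Qxy xv2 xsupp ysupp]]] := path_vector vk vk' dkS.
have yr : y r = 0 by apply: ysupp; rewrite M_S.
have row : \sum_i x i * B i r = x v * B v r.
  apply: sum_row => i iv; have [iM|iM] := boolP (i \in M k.+1); last first.
    by rewrite xsupp ?iM ?orbT ?mul0r.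
  by rewrite (@non_edge k.+1) ?mulr0 // -M_S.
have := B_ge0 x (bump_at y r (x v * B v r / 2)).
rewrite defect_bump // row; apply/negP; rewrite -ltNge final //.
by rewrite exprMn xv2 mul1r.
Qed.
End NoMixing.

(** * Cyclotomic matrices *)

(** Rayleigh bound: in a unitary eigenbasis the form is a combination of eigenvalues with
    nonnegative weights w w^*. *)
Lemma real_symmetric_quad_bound (n : nat) (A : 'M[algC]_n) (c : algC) (u : 'rV_n) :
  A^T = A -> (forall i j, A i j \is Num.real) ->
  (forall x, eigenvalue A x -> x <= c) ->
  (forall i, u 0 i \is Num.real) ->
  (u *m A *m u^T) 0 0 <= c * \sum_i u 0 i ^+ 2.
Proof.
move=> Asym Areal eigA ureal.
have /orthomx_spectralP : A \is normalmx.
  apply: symmetric_normalmx; last by apply/mxOverP.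
  by apply/is_hermitianmxP; rewrite expr0 scale1r map_mx_id.
set P := spectralmx A; set d := spectral_diag A => defA.
have Pu : P \in unitmx := spectral_unit A.
have Pi : invmx P = map_mx Num.conj P^T := invmx_unitary (spectral_unitarymx A).
have PA : P *m A = diag_mx d *m P by rewrite {1}defA !mulmxA mulmxV // mul1mx.
have d_le i : d 0 i <= c.
  apply: eigA; apply/eigenvalueP; exists (row i P).
    by rewrite -row_mul PA row_mul row_diag_mx -scalemxAl -rowE.
  apply: contraTneq Pu => Pi0; rewrite -row_free_unit -kermx_eq0.
  apply/rowV0Pn; exists (delta_mx 0 i); last first.
    by apply/eqP=> /rowP/(_ i)/eqP; rewrite !mxE !eqxx oner_eq0.
  by apply/sub_kermxP; rewrite -rowE.
have uconj : u^T = map_mx Num.conj u^T.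
  by apply/matrixP=> i j; rewrite !mxE conj_Creal // (ord1 j).
pose w := u *m invmx P.
have wE : map_mx Num.conj w^T = P *m u^T.
  rewrite /w trmx_mul map_mxM /= -uconj Pi.
  by congr (_ *m _); apply/matrixP=> i j; rewrite !mxE conjCK.
have -> : \sum_i u 0 i ^+ 2 = \sum_i w 0 i * (w 0 i)^*.
  transitivity ((u *m u^T) 0 0).
    by rewrite mxE; apply: eq_bigr => i _; rewrite mxE expr2.
  have -> : u *m u^T = w *m map_mx Num.conj w^T by rewrite wE mulmxA mulmxKV.
  by rewrite mxE; apply: eq_bigr => i _; rewrite !mxE.
have -> : u *m A *m u^T = w *m diag_mx d *m map_mx Num.conj w^T.
  by rewrite {1}defA wE /w !mulmxA.
rewrite mxE mulr_sumr ler_sum // => i _.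
rewrite mul_mx_diag !mxE [_ * d 0 i]mulrC -mulrA.
by rewrite ler_wpM2r ?d_le // mul_conjC_ge0.
Qed.

(** An integral characteristic polynomial is fixed by [u], so the eigenvalues stay the same; the
    entries stay real because [in_Rcomp] is stable under [u]. *)
Lemma cyclotomic_aut (n : nat) (A : 'M[algC]_n) (u : {rmorphism algC -> algC}) :
  (forall i j, in_Rcomp (A i j)) -> cyclotomic_mx A -> cyclotomic_mx (map_mx u A).
Proof.
move=> RA [Asym _ Achar Aeig].
have charE : char_poly (map_mx u A) = char_poly A.
  rewrite -map_char_poly; apply/polyP=> k; rewrite coef_map /=.
  by have /intrP[m ->] := Achar k; rewrite rmorph_int.
split=> [|i j|k|x]; rewrite ?charE //.
- by apply/matrixP=> i j; rewrite !mxE -[in LHS]Asym mxE.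
- by rewrite mxE; apply/in_Rcomp_real/in_Rcomp_aut.
- by rewrite eigenvalue_root_char charE -eigenvalue_root_char; apply: Aeig.
Qed.

(** Polarization: the quadratic bound for A at x + y and for -A at x - y add up to four times the
    claim. *)
Lemma cyclotomic_bilinear_bound (n : nat) (A : 'M[algC]_n) (x y : 'rV_n) :
  cyclotomic_mx A -> (forall i, x 0 i \is Num.real) -> (forall i, y 0 i \is Num.real) ->
  (x *m A *m y^T) 0 0 <= \sum_i x 0 i ^+ 2 + \sum_i y 0 i ^+ 2.
Proof.
move=> [Asym Areal _ Aeig] xR yR.
have NAeig t : eigenvalue (- A) t -> t <= 2.
  case/eigenvalueP=> v vA v0; suff /Aeig/andP[] : eigenvalue A (- t) by rewrite lerN2.
  by apply/eigenvalueP; exists v => //; rewrite scaleNr -vA mulmxN opprK.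
have H2 : ((x + y) *m A *m (x + y)^T) 0 0 <= 2 * \sum_i (x + y) 0 i ^+ 2.
  apply: real_symmetric_quad_bound => // [t /Aeig/andP[] //|i].
  by rewrite mxE rpredD.
have H1 : ((x - y) *m (- A) *m (x - y)^T) 0 0 <= 2 * \sum_i (x - y) 0 i ^+ 2.
  apply: real_symmetric_quad_bound => // [|i j|i]; first by rewrite linearN /= Asym.
    by rewrite mxE rpredN.
  by rewrite !mxE rpredB.
have := lerD H1 H2.
have -> : ((x - y) *m (- A) *m (x - y)^T) 0 0 + ((x + y) *m A *m (x + y)^T) 0 0 =
    4 * (x *m A *m y^T) 0 0.
  have yx : y *m A *m x^T = x *m A *m y^T.
    have <- : (y *m A *m x^T)^T = x *m A *m y^T by rewrite !trmx_mul trmxK Asym mulmxA.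
    by apply/matrixP=> i j; rewrite !ord1 [RHS]mxE.
  rewrite !linearD !linearN /= !(mulmxDl, mulmxDr, mulmxN, mulNmx) yx.
  move: (x *m A *m x^T) (x *m A *m y^T) (y *m A *m y^T) => a b c.
  by rewrite !mxE; ring.
have -> : 2 * \sum_i (x - y) 0 i ^+ 2 + 2 * \sum_i (x + y) 0 i ^+ 2 =
    4 * (\sum_i x 0 i ^+ 2 + \sum_i y 0 i ^+ 2).
  rewrite -mulrDr -!big_split /= !mulr_sumr; apply: eq_bigr => i _.
  by rewrite !mxE; ring.
by rewrite ler_pM2l ?ltr0n.
Qed.

(** Moves real values into the totally ordered field [algR], where [defect] is available; on a
    non-real argument it returns the real part. *)
Definition algR_of (x : algC) : algR := in_algR (Creal_Re x).

Lemma algR_ofK x : x \is Num.real -> algRval (algR_of x) = x.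
Proof. by move=> xR; rewrite /= (Creal_ReP _ _). Qed.

Lemma cyclotomic_defect_ge0 (n : nat) (A : 'M[algC]_n) (x y : 'I_n -> algR) :
  cyclotomic_mx A -> 0 <= defect (map_mx algR_of A) x y.
Proof.
move=> cA; have [_ Areal _ _] := cA.
pose X := \row_i algRval (x i); pose Y := \row_i algRval (y i).
have XR i : X 0 i \is Num.real by rewrite mxE; apply: algRvalP.
have YR i : Y 0 i \is Num.real by rewrite mxE; apply: algRvalP.
have := cyclotomic_bilinear_bound cA XR YR; rewrite -subr_ge0.
suff -> : \sum_i X 0 i ^+ 2 + \sum_i Y 0 i ^+ 2 - (X *m A *m Y^T) 0 0 =
  algRval (defect (map_mx algR_of A) x y) by [].
rewrite /defect rmorphB rmorphD !rmorph_sum /=; congr (_ + _ - _).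
- by apply: eq_bigr => i _; rewrite mxE.
- by apply: eq_bigr => i _; rewrite mxE.
rewrite mxE; transitivity (\sum_j \sum_i X 0 i * A i j * Y 0 j).
  by apply: eq_bigr => j _; rewrite [Y^T _ _]mxE [(X *m A) _ _]mxE mulr_suml.
rewrite exchange_big; apply: eq_bigr => i _; rewrite rmorph_sum; apply: eq_bigr => j _.
by rewrite !mxE /= (Creal_ReP _ _).
Qed.

(** For a = A i j, the defect at e_i and (a/2) e_j is 1 - a^2/4. *)
Lemma cyclotomic_entry_le (n : nat) (A : 'M[algC]_n) i j :
  cyclotomic_mx A -> A i j ^+ 2 <= 4.
Proof.
move=> cA; have [_ Areal _ _] := cA.
have Aij : algRval (map_mx algR_of A i j) = A i j by rewrite mxE algR_ofK.
rewrite -Aij; move: (map_mx algR_of A) (fun x y => @cyclotomic_defect_ge0 _ _ x y cA) => B B0.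
have := B0 (bump_at (fun=> 0) i 1) (bump_at (fun=> 0) j (B i j / 2)).
rewrite defect_bump // defect_delta (bigD1 i) //= big1 => [|k /negPf ki]; last first.
  by rewrite /bump_at ki addr0 mul0r.
rewrite /bump_at eqxx => B1; suff : B i j ^+ 2 <= 4.
  by rewrite -[_ <= _]/(algRval (B i j ^+ 2) <= algRval 4) rmorphXn rmorph_nat.
by nra.
Qed.

Lemma golden_quartic_cases (x : algC) : x ^+ 4 - 3 * x ^+ 2 + 1 = 0 ->
  (2 * x - 1) ^+ 2 = 5 \/ (2 * x + 1) ^+ 2 = 5.
Proof.
have -> : x ^+ 4 - 3 * x ^+ 2 + 1 = ((2 * x - 1) ^+ 2 - 5) * ((2 * x + 1) ^+ 2 - 5) / 16.
  by field.
move/eqP; rewrite !mulf_eq0 invr_eq0 (pnatr_eq0 _ 16) orbF !subr_eq0.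
by case/orP=> /eqP; [left|right].
Qed.

(** Here 2x - 1 or 2x + 1 is a square root of 5. Negating it exchanges the two roots of X^2 - 3X +
    1, of which x^2 is one; their sum is 3. *)
Lemma aut_golden (u : {rmorphism algC -> algC}) (b : bool) x :
  (forall y, y ^+ 2 = 5 -> u y = (-1) ^+ b * y) -> x ^+ 4 - 3 * x ^+ 2 + 1 = 0 ->
  if b then u x ^+ 2 + x ^+ 2 = 3 else u x = x.
Proof.
move=> u5 x4.
have u2x (c : algC) : u (2 * x + c) = 2 * u x + u c.
  by rewrite rmorphD rmorphM rmorph_nat.
have n2 : 2 != 0 :> algC by rewrite pnatr_eq0.
case: (golden_quartic_cases x4) => /[dup] x5 /u5; rewrite u2x ?rmorphN rmorph1;
  case: b {u5} => /=; rewrite ?expr1 ?expr0 ?mul1r => uE.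
- have -> : u x = 1 - x by apply: (mulfI n2); rewrite -[LHS](subrK 1) uE; ring.
  have -> : (1 - x) ^+ 2 + x ^+ 2 = ((2 * x - 1) ^+ 2 + 1) / 2 by field.
  by rewrite x5; field.
- by apply: (mulfI n2); apply: (addIr (-1)).
- have -> : u x = -1 - x by apply: (mulfI n2); rewrite -[LHS](addrK 1) uE; ring.
  have -> : (-1 - x) ^+ 2 + x ^+ 2 = ((2 * x + 1) ^+ 2 + 1) / 2 by field.
  by rewrite x5; field.
- by apply: (mulfI n2); apply: (addIr 1).
Qed.

Lemma int_sq_ge1 (x : algC) : x \in Num.int -> x != 0 -> 1 <= x ^+ 2.
Proof.
move=> xZ x0; rewrite -(intr_normK xZ) -(expr1n _ 2) ler_pXn2r ?nnegrE ?normr_ge0 //.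
by rewrite norm_intr_ge1.
Qed.

Lemma algR_of_sq_le (m : nat) x : x \is Num.real ->
  (m%:R <= algR_of x ^+ 2) = (m%:R <= x ^+ 2).
Proof.
move=> xR; rewrite -[LHS]/(algRval m%:R <= algRval (algR_of x ^+ 2)).
by rewrite rmorph_nat rmorphXn /= (Creal_ReP _ _).
Qed.

Lemma algR_of_sq_lt (m : nat) x : x \is Num.real ->
  (m%:R < algR_of x ^+ 2) = (m%:R < x ^+ 2).
Proof.
move=> xR; rewrite -[LHS]/(algRval m%:R < algRval (algR_of x ^+ 2)).
by rewrite rmorph_nat rmorphXn /= (Creal_ReP _ _).
Qed.

Lemma algR_of_eq0 x : x \is Num.real -> (algR_of x == 0) = (x == 0).
Proof. by move=> xR; rewrite -[LHS](inj_eq val_inj) /= (Creal_ReP _ _). Qed.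

(** * At most one kind of irrationality occurs among the entries *)

Section Unmixed.
Variables (n : nat) (A : 'M[algC]_n).
Hypothesis RA : forall i j, in_Rcomp (A i j).
Hypothesis cA : cyclotomic_mx A.
Hypothesis indA : indecomposable A.

Let Asym i j : A i j = A j i.
Proof. by have [At _ _ _] := cA; rewrite -{1}At mxE. Qed.

Lemma entry_cases i j : [\/ A i j \in Num.int, A i j ^+ 2 = 2, A i j ^+ 2 = 3
  | A i j ^+ 4 - 3 * A i j ^+ 2 + 1 = 0].
Proof.
apply: Rcomp_small_cases => // u.
by have := cyclotomic_entry_le i j (cyclotomic_aut u RA cA); rewrite mxE.
Qed.

(** The square root of 2 takes precedence: a competing irrationality is golden if e = 3, and golden
    or of square 3 if e = 2. A closest competing row to the heavy rows contradicts [no_mixing]. *)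
Lemma entries_unmixed (e : nat) : e = 2%N \/ e = 3%N ->
  (forall i j, A i j ^+ 2 = 2 -> e = 2%N) ->
  (exists i j, A i j ^+ 2 = e%:R) ->
  forall i j, A i j \in Num.int \/ A i j ^+ 2 = e%:R.
Proof.
move=> e23 e2 [i0 [j0 ij0]] i1 j1.
have [|i1Z] := boolP (A i1 j1 \in Num.int); first by left.
have [|i1e] := eqVneq (A i1 j1 ^+ 2) e%:R; first by right.
pose T := [set i | [exists j, A i j ^+ 2 == e%:R]].
pose S := [set i | [exists j, (A i j \notin Num.int) && (A i j ^+ 2 != e%:R)]].
have i0T : i0 \in T by rewrite inE; apply/existsP; exists j0; apply/eqP.
have i1S : i1 \in S by rewrite inE; apply/existsP; exists j1; rewrite i1Z.
have [k [v vSk dkS]] := first_meeting i0T i1S (indA i0 i1).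
exfalso; have : v \in S by move: vSk; rewrite inE => /andP[].
rewrite inE => /existsP[r /andP[vrZ vre]].
have rS : r \in S.
  by rewrite inE; apply/existsP; exists v; rewrite Asym vrZ.
have vr_cases : (e = 2%N /\ A v r ^+ 2 = 3) \/ A v r ^+ 4 - 3 * A v r ^+ 2 + 1 = 0.
  case: (entry_cases v r) => [H|H|H|]; last by right.
  - by rewrite H in vrZ.
  - by rewrite (e2 _ _ H) H eqxx in vre.
  left; split => //; case: e23 => // e3; by rewrite e3 H eqxx in vre.
have Rreal (u : {rmorphism algC -> algC}) i j : u (A i j) \is Num.real by apply/in_Rcomp_real/in_Rcomp_aut.
(* The competing entry must have square above 2. This holds for square 3, and for one of the two
   conjugates of a golden entry. *)
have [u [ue ue4 u_gt2]] : exists u : {rmorphism algC -> algC},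
    [/\ forall x, x ^+ 2 = 2 \/ x ^+ 2 = 3 -> u x = x,
        forall x : algC, x ^+ 4 - 3 * x ^+ 2 + 1 = 0 -> u x ^+ 4 - 3 * u x ^+ 2 + 1 = 0
      & 2 < u (A v r) ^+ 2].
  have [gt2|le2] := boolP (2 < A v r ^+ 2); first by exists idfun; split.
  have vr4 : A v r ^+ 4 - 3 * A v r ^+ 2 + 1 = 0.
    by case: vr_cases => // -[_ H]; rewrite H ltr_nat in le2.
  have [u uE] := @sqrt_sign_aut false false true isT; exists u; split.
  - by move=> x [] H; have [u2 u3 _] := uE x; rewrite ?(u2 H) ?(u3 H) mul1r.
  - move=> x x4; have -> : u x ^+ 4 - 3 * u x ^+ 2 + 1 = u (x ^+ 4 - 3 * x ^+ 2 + 1).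
      by rewrite rmorphD rmorphB (rmorphM u 3) !rmorphXn rmorph1 rmorph_nat.
    by rewrite x4 rmorph0.
  have usum := @aut_golden u true _ (fun y => let: And3 _ _ h := uE y in h) vr4.
  have {usum} uvr : u (A v r) ^+ 2 = 3 - A v r ^+ 2 by rewrite -usum addrK.
  have vrR : A v r ^+ 2 \is Num.real by rewrite rpredX ?(Rreal idfun).
  rewrite -real_leNgt ?realn // le_eqVlt in le2; case/orP: le2 => [/eqP H|lt2].
    move: vr4; rewrite -[4%N]/(2 * 2)%N exprM H => /eqP.
    have -> : 2 ^+ 2 - 3 * 2 + 1 = -1 :> algC by ring.
    by rewrite oppr_eq0 oner_eq0.
  (* With s the square of the entry this is (2 - s)(1 - s) = s^2 - 3s + 2, equal to 1 by the
     quartic, so both factors have the same sign. *)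
  have nz : (2 - A v r ^+ 2) * (u (A v r) ^+ 2 - 2) = 1.
    by rewrite uvr -[RHS]addr0 -vr4; ring.
  by rewrite -subr_gt0 -(pmulr_rgt0 _ (_ : 0 < 2 - A v r ^+ 2)) ?subr_gt0 // nz ltr01.
(* [f] negates the heavy entries while fixing the competing one; it defines [B']. *)
have [f fE] : exists f : {rmorphism algC -> algC}, [/\ forall x, x ^+ 2 = e%:R -> f x = - x,
    forall x, e = 2%N -> x ^+ 2 = 3 -> f x = x & forall x, x ^+ 2 = 5 -> f x = x].
  case: e23 => ->; last first.
    have [f fE] := @sqrt_sign_aut false true false isT; exists f.
    split=> // x H; have [f2 f3 f5] := fE x; first by rewrite (f3 H) mulN1r.
    by rewrite (f5 H) mul1r.
  have [f fE] := @sqrt_sign_aut true false false isT; exists f.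
  split=> // x; have [f2 f3 f5] := fE x; first by move/f2->; rewrite mulN1r.
    by move=> _ /f3->; rewrite mul1r.
  by move/f5->; rewrite mul1r.
have [fe f3 f5] := fE.
have uA := cyclotomic_aut u RA cA.
have RuA i j : in_Rcomp (map_mx u A i j) by rewrite mxE; apply: in_Rcomp_aut.
have fuA := cyclotomic_aut f RuA uA.
have sq_e (x : algC) : x ^+ 2 = e%:R -> x ^+ 2 = 2 \/ x ^+ 2 = 3.
  by case: e23 => -> ->; [left|right].
pose B := map_mx algR_of (map_mx u A).
pose B' := map_mx algR_of (map_mx f (map_mx u A)).
have BE i j : B i j = algR_of (u (A i j)) by rewrite !mxE.
have B'E i j : B' i j = algR_of (f (u (A i j))) by rewrite !mxE.
have Bsym : B^T = B by apply/matrixP=> i j; rewrite mxE !BE Asym.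
have B'sym : B'^T = B' by apply/matrixP=> i j; rewrite mxE !B'E Asym.
have B0 i j : (B i j == 0) = (A i j == 0) by rewrite BE algR_of_eq0 // fmorph_eq0.
have light i j : i \notin S -> A i j \in Num.int \/ A i j ^+ 2 = e%:R.
  rewrite inE negb_exists => /forallP/(_ j); rewrite negb_and !negbK.
  by case/orP=> [|/eqP]; [left|right].
apply: (@no_mixing _ _ (mx_graph A) T S B B' Bsym B'sym _ _ _ _ _ _ _ k v r vSk dkS rS).
- by move=> x y; apply: cyclotomic_defect_ge0.
- by move=> x y; apply: cyclotomic_defect_ge0.
- by move=> i j /andP[_]; rewrite B0.
- by move=> i j ij; rewrite B0 /mx_graph ij.
- move=> i; rewrite inE => /existsP[q /eqP iq]; exists q.
    by rewrite inE; apply/existsP; exists i; rewrite Asym iq.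
  rewrite B'E BE (ue _ (sq_e _ iq)) (fe _ iq); split.
    rewrite (algR_of_sq_le 2) ?(Rreal idfun) // iq ler_nat.
    by case: e23 => ->.
  by apply: val_inj; rewrite /= raddfN.
- move=> i j iS; rewrite B0 => ij0'; rewrite BE (algR_of_sq_le 1) //.
  case: (light i j iS) => [ijZ|ije].
    by rewrite (aut_intr u ijZ) int_sq_ge1.
  by rewrite (ue _ (sq_e _ ije)) ije ler_nat; case: e23 => ->.
- move=> i j iS jT; rewrite B'E BE; congr algR_of.
  case: (light i j iS) => [ijZ|ije]; first by rewrite (aut_intr u ijZ) (aut_intr f ijZ).
  by case/negP: jT; rewrite inE; apply/existsP; exists i; rewrite Asym ije.
- by rewrite BE (algR_of_sq_lt 2).
rewrite B'E BE; congr algR_of; case: vr_cases => [[e2' vr3]|vr4].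
  by rewrite ue ?f3 //; right.
by apply: (@aut_golden f false) => [y y5|]; [rewrite (f5 _ y5) mul1r | apply: ue4].
Qed.

End Unmixed.

Theorem theorem8 (n : nat) (A : 'M[algC]_n) :
  (forall i j, in_Rcomp (A i j)) ->
  cyclotomic_mx A -> indecomposable A ->
  A^T = A /\
  [\/ (forall i j, A i j \in Num.int),
      (forall i j, in_Zadj (sqrtC 2%:R) (A i j)),
      (forall i j, in_Zadj phi_gold (A i j))
    | (forall i j, in_Zadj (sqrtC 3%:R) (A i j))].
Proof.
move=> RA cA indA; split; first by case: cA.
have Zadj_int w x : x \in Num.int -> in_Zadj w x.
  by case/intrP=> m ->; exists m, 0; rewrite mul0r addr0.
have Zadj_sqrt (e : nat) x : x \in Num.int \/ x ^+ 2 = e%:R -> in_Zadj (sqrtC e%:R) x.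
  case=> [/Zadj_int //|/eqP]; rewrite -{1}(sqrtCK e%:R) eqf_sqr => /orP[] /eqP ->.
    by exists 0, 1; rewrite mul1r add0r.
  by exists 0, (-1); rewrite mulN1r add0r.
have Zadj_phi x : x ^+ 4 - 3 * x ^+ 2 + 1 = 0 -> in_Zadj phi_gold x.
  have n2 : 2 != 0 :> algC by rewrite pnatr_eq0.
  (* The four roots of the quartic are phi, 1 - phi, phi - 1 and -phi. *)
  have E y (a b : int) : y = a%:~R + b%:~R * ((1 + sqrtC 5%:R) / 2) -> in_Zadj phi_gold y.
    by exists a, b.
  case/golden_quartic_cases => /eqP; rewrite -{1}(sqrtCK 5) eqf_sqr.
    case/orP=> /eqP H; [apply: (E _ 0 1)|apply: (E _ 1 (-1))];
      by apply: (mulfI n2); apply: (addIr (-1)); rewrite H; field.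
  case/orP=> /eqP H; [apply: (E _ (-1) 1)|apply: (E _ 0 (-1))];
    by apply: (mulfI n2); apply: (addIr 1); rewrite H; field.
have dec (e : nat) : (exists i j, A i j ^+ 2 = e%:R) \/ (forall i j, A i j ^+ 2 != e%:R).
  have [/existsP[i /existsP[j /eqP]]|] := boolP [exists i, [exists j, A i j ^+ 2 == e%:R]].
    by left; exists i, j.
  rewrite negb_exists => /forallP H; right=> i j.
  by have := H i; rewrite negb_exists => /forallP/(_ j).
(* Square 2 is tested before square 3, as [entries_unmixed] requires. With neither present every
   entry is an integer or golden, hence in Z[phi]. *)
have [ex2|no2] := dec 2%N.
  constructor 2 => i j; apply: Zadj_sqrt.
  by apply: (entries_unmixed RA cA indA) ex2 _ _; [left|].
have [ex3|no3] := dec 3%N.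
  constructor 4 => i j; apply: Zadj_sqrt.
  apply: (entries_unmixed RA cA indA) ex3 _ _; [by right|] => i' j' /eqP.
  by rewrite (negPf (no2 i' j')).
constructor 3 => i j; case: (entry_cases RA cA i j) => [/Zadj_int //|/eqP|/eqP|/Zadj_phi //].
  by rewrite (negPf (no2 i j)).
by rewrite (negPf (no3 i j)).
Qed.
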